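(* Let $S$ be a set of $n$ points in the plane in convex position. Then the number of ordered ncp partitions that $S$ admits is $\mathcal{O}^*(4.642126305^n)$.
   Context: A non-crossing path partition (ncp partition) of a planar point set $S$ is a graph with vertex set $S$ and straight-line edges, no two of which cross, every connected component of which is a path; isolated vertices (singletons) are allowed and regarded as paths of length $0$. For $S$ a set of $n$ points in convex position numbered clockwise from $1$ to $n$, an ordered ncp partition is an ncp partition of $S$ such that whenever $i<j$ are the two endpoints of a path, no endpoint of any other path lies strictly between $i$ and $j$ (in this numbering). The notation $\mathcal{O}^*(c^n)$ means $O(p(n)\,c^n)$ for some polynomial $p$, i.e. polynomial factors are neglected. *)

(* Defs.v *)
From HB Require Import structures.
From mathcomp Require Import all_boot all_order all_algebra.
From mathcomp Require Import boolp reals.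
Set Implicit Arguments. Unset Strict Implicit. Unset Printing Implicit Defensive.
Import Order.TTheory GRing.Theory Num.Theory.
Local Open Scope ring_scope.

Section Defs.
Variable R : realType.

Definition pt := (R * R)%type.

(* Orientation determinant of the triple (a, b, c); negative = clockwise. *)
Definition orient (a b c : pt) : R :=
  (b.1 - a.1) * (c.2 - a.2) - (b.2 - a.2) * (c.1 - a.1).

(* n distinct points p 0, ..., p (n-1) in (strictly) convex position,
   numbered clockwise: every triple taken in index order is a clockwise turn. *)
Definition convex_clockwise (n : nat) (p : 'I_n -> pt) : Prop :=
  injective p /\
  forall i j k : 'I_n, (i < j)%N -> (j < k)%N -> orient (p i) (p j) (p k) < 0.

Definition on_seg (a b x : pt) : Prop :=
  exists t : R, 0 <= t <= 1 /\
    x.1 = a.1 + t * (b.1 - a.1) /\ x.2 = a.2 + t * (b.2 - a.2).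

Variable n : nat.
Variable p : 'I_n -> pt.
Variable E : {set {set 'I_n}}.   (* edge set of a graph on vertex set S = p('I_n) *)

Definition edges_ok : Prop := forall e, e \in E -> #|e| = 2.

Definition noncrossing : Prop :=
  forall e f, e \in E -> f \in E -> e != f ->
  forall (u v w z : 'I_n) (x : pt), e = [set u; v] -> f = [set w; z] ->
    on_seg (p u) (p v) x -> on_seg (p w) (p z) x ->
    exists y, y \in e :&: f /\ x = p y.

Definition pedges (s : seq 'I_n) : seq {set 'I_n} :=
  [seq [set xy.1; xy.2] | xy <- zip s (behead s)].

(* s (a nonempty list of distinct vertices) is a connected component of the
   graph, and this component is the path s: the edges touching s are exactly
   the edges between consecutive vertices of s. *)
Definition is_path_comp (s : seq 'I_n) : Prop :=
  s != [::] /\ uniq s /\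
  (forall e, e \in E -> (exists x, x \in e /\ x \in s) -> e \in pedges s) /\
  (forall e, e \in pedges s -> e \in E).

Definition endpoint (s : seq 'I_n) (y : 'I_n) : Prop :=
  exists a s', s = a :: s' /\ (y = a \/ y = last a s').

(* every connected component is a path (singletons allowed) *)
Definition all_paths : Prop := forall x, exists s, x \in s /\ is_path_comp s.

Definition ncp_partition : Prop := edges_ok /\ noncrossing /\ all_paths.

Definition ordered_cond : Prop :=
  forall s t (i j y : 'I_n), is_path_comp s -> is_path_comp t ->
    (forall x, x \in t -> x \notin s) ->
    endpoint s i -> endpoint s j -> (i < j)%N -> endpoint t y ->
    ~ ((i < y)%N /\ (y < j)%N).

Definition ordered_ncp_partition : Prop := ncp_partition /\ ordered_cond.

End Defs.

Definition num_ordered_ncp (R : realType) (n : nat) (p : 'I_n -> pt R) : nat :=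
  #|[set E : {set {set 'I_n}} | `[< ordered_ncp_partition p E >] ]|.

(* Main.v *)
Require Import Defs.
From HB Require Import structures.
From mathcomp Require Import all_boot all_order all_algebra.
From mathcomp Require Import boolp reals.
From mathcomp Require Import zify ring lra.
Import Order.TTheory GRing.Theory Num.Theory.

(** Let [i < j] be the endpoints of a path.  A gap of its block inside [(i, j)] would
contain a whole block of the partition, hence an endpoint; so the points between [i]
and [j] all belong to the path.  Walking along the path from [i], the visited points of
the block always span a circular arc: a step either goes to the next point on the side
of [j], or skips a gap on the other side, which carries an independent ordered
partition, and [j] is visited last.  Once the least point of the interval is visited,
the other side wraps around to the end of the interval.  Ordered partitions are thus
produced by a grammar whose generating functions satisfy
  [F = 1 + z F + z (H + W)],  [W = z F + z W + z F W],  [H = z H + z F (H + W)],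
where [W] counts the continuations of a block whose least point has been visited and
[H] those of a block whose least point is still to come.  The dominant singularity is
at [1 / 4.64212630382...], so at [z = 1 / 4.642126305] there is a finite
super-solution, which bounds the number of partitions by [F / z ^ n]. *)

Set Implicit Arguments. Unset Strict Implicit. Unset Printing Implicit Defensive.
Local Open Scope ring_scope.

(** * Counting *)

Definition edge_list := seq (nat * nat).

(** Equality [a = l] means that no point is left on the side of the least point, which has thus been
    visited; what remains is a single interval, used from both ends. *)
Definition gen_phase (W : nat -> nat -> nat -> seq edge_list)
    (H : nat -> nat -> nat -> nat -> nat -> seq edge_list) a l r b c :=
  if a == l then W r b c else H a l r b c.

(* [k] is fuel.  [genF k a b] lists edge sets on the points [a <= y < b].  In [genW] and
   [genH], [c] is the last visited point of a block and the points left to use are those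
   with [r < y < l], resp. [a <= y < l] or [r < y < b]; in [genH], [a] belongs to the
   block.  In [genF], [i] is the smaller endpoint of the block of [a]. *)
Fixpoint genF k a b : seq edge_list :=
  if k is k'.+1 then
    if a == b then [:: [::]] else
    genF k' a.+1 b ++
    flatten [seq gen_phase (genW k') (genH k') a i i b i | i <- iota a (b - a)]
  else [::]
with genW k r l c : seq edge_list :=
  if k is k'.+1 then
    (if r.+1 < l then
      [seq (c, r.+1) :: e | e <- genF k' r.+2 l] ++
      [seq (c, r.+1) :: e | e <- genW k' r.+1 l r.+1] else [::])%N ++
    flatten [seq [seq (c, x) :: e1 ++ e2 | e1 <- genF k' x.+1 l, e2 <- genW k' r x x]
            | x <- iota r.+1 (l - r.+1)]
  else [::]
with genH k a l r b c : seq edge_list :=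
  if k is k'.+1 then
    (if r.+1 < b then [seq (c, r.+1) :: e | e <- genH k' a l r.+1 b r.+1] else [::])%N ++
    flatten [seq [seq (c, x) :: e1 ++ e2 | e1 <- genF k' x.+1 l,
                                           e2 <- gen_phase (genW k') (genH k') a x r b x]
            | x <- iota a (l - a)]
  else [::].

(** * Generating polynomials of the grammar *)

Section GeneratingPolynomials.
Variable R : realFieldType.

(** Iterates of the system from 0, one per unit of fuel. The third component is bivariate: its outer
    variable marks the points with [a <= y < l], its inner variable those with [r < y < b].
    Evaluation at ['X] merges the two and gives the [H] of the system. *)
Fixpoint gpoly k : {poly R} * {poly R} * {poly {poly R}} :=
  if k is k'.+1 then
    let: (F, W, H) := gpoly k' in
    (1 + 'X * F + 'X * (H + W%:P).['X],
     'X * F + 'X * W + 'X * (F * W),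
     'X%:P * H + 'X * (map_poly polyC F * (H + W%:P)))
  else (0, 0, 0).

Definition polyF k := (gpoly k).1.1.
Definition polyW k := (gpoly k).1.2.
Definition polyH k := (gpoly k).2.

Lemma polyFS k : polyF k.+1 = 1 + 'X * polyF k + 'X * (polyH k + (polyW k)%:P).['X].
Proof. by rewrite /polyF /polyH /polyW /=; case: gpoly => [[]]. Qed.

Lemma polyWS k : polyW k.+1 = 'X * polyF k + 'X * polyW k + 'X * (polyF k * polyW k).
Proof. by rewrite /polyF /polyW /=; case: gpoly => [[]]. Qed.

Lemma polyHS k : polyH k.+1 = 'X%:P * polyH k +
  'X * (map_poly polyC (polyF k) * (polyH k + (polyW k)%:P)).
Proof. by rewrite /polyF /polyH /polyW /=; case: gpoly => [[]]. Qed.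

Definition diagH k := (polyH k).['X].

Lemma diagHS k : diagH k.+1 = 'X * diagH k + 'X * (polyF k * (diagH k + polyW k)).
Proof.
rewrite /diagH polyHS !(hornerE, hornerM).
have -> : (map_poly polyC (polyF k)).['X] = polyF k.
  by rewrite -[LHS]/(polyF k \Po 'X) comp_polyXr.
by [].
Qed.

Lemma diagH_phase k : (polyH k + (polyW k)%:P).['X] = diagH k + polyW k.
Proof. by rewrite hornerD hornerC. Qed.

Lemma gpoly_nneg k i : [/\ 0 <= (polyF k)`_i, 0 <= (polyW k)`_i & 0 <= (diagH k)`_i].
Proof.
have hX (p : {poly R}) : (forall i, 0 <= p`_i) -> forall i, 0 <= ('X * p)`_i.
  by move=> hp [|m]; rewrite coefXM /=.
have hM (p q : {poly R}) : (forall i, 0 <= p`_i) -> (forall i, 0 <= q`_i) ->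
    forall i, 0 <= (p * q)`_i.
  by move=> hp hq m; rewrite coefM sumr_ge0 // => l _; rewrite mulr_ge0.
have hD (p q : {poly R}) : (forall i, 0 <= p`_i) -> (forall i, 0 <= q`_i) ->
    forall i, 0 <= (p + q)`_i.
  by move=> hp hq m; rewrite coefD addr_ge0.
elim: k i => [|k IHk] i.
  by rewrite /polyF /polyW /diagH /polyH /= horner0 !coef0.
have hF m : 0 <= (polyF k)`_m by have [] := IHk m.
have hW m : 0 <= (polyW k)`_m by have [] := IHk m.
have hH m : 0 <= (diagH k)`_m by have [] := IHk m.
have h1 m : 0 <= (1 : {poly R})`_m by rewrite coef1.
rewrite polyFS polyWS diagHS diagH_phase.
split; first exact: (hD _ _ (hD _ _ h1 (hX _ hF)) (hX _ (hD _ _ hH hW))).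
  exact: (hD _ _ (hD _ _ (hX _ hF) (hX _ hW)) (hX _ (hM _ _ hF hW))).
exact: (hD _ _ (hX _ hH) (hX _ (hM _ _ hF (hD _ _ hH hW)))).
Qed.

Lemma hornerX_coef2 (P : {poly {poly R}}) m :
  P.['X]`_m = \sum_(i < m.+1) P`_i`_(m - i).
Proof.
rewrite (@horner_coef_wide _ (maxn m.+1 (size P))) ?leq_maxr // coef_sum.
rewrite (big_ord_widen _ (fun i => P`_i`_(m - i)) (leq_maxl m.+1 (size P))).
rewrite [RHS]big_mkcond; apply: eq_bigr => i _ /=.
by rewrite coefMXn ltnS; case: leqP.
Qed.

Lemma size_flatten_iota (T : Type) (f : nat -> seq T) (g : nat -> R) a m :
  (forall j, (j < m)%N -> (size (f (a + j)%N))%:R <= g j) ->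
  (size (flatten [seq f x | x <- iota a m]))%:R <= \sum_(j < m) g j.
Proof.
move=> h; rewrite size_flatten /shape -map_comp sumnE big_map.
rewrite -[X in iota X](addn0 a) iotaDl big_map -{1}[m]subn0 big_mkord natr_sum.
by apply: ler_sum => i _; apply: h.
Qed.

(** In [polyH k + (polyW k)%:P] the coefficient of outer degree 0 is thus [polyW k] alone, and the
    others come from [polyH k]: the sum mirrors the case distinction of [gen_phase]. *)
Lemma polyH0 k : (polyH k)`_0 = 0.
Proof.
elim: k => [|k IHk]; first by rewrite /polyH /= coef0.
by rewrite polyHS coefD coefCM coefXM IHk mulr0 addr0.
Qed.

(** Each branch of the grammar matches one summand of the recursion: a step to the next point
    multiplies by a variable, and a skipped gap gives a convolution with [polyF]. Fuel and number of
    iterations agree, so the bound holds for intervals of any length. *)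
Lemma size_gen k :
  [/\ forall a b, (a <= b)%N -> (size (genF k a b))%:R <= (polyF k)`_(b - a),
      forall r l c, (r < l)%N -> (size (genW k r l c))%:R <= (polyW k)`_(l - r.+1) &
      forall a l r b c, (a < l)%N -> (r < b)%N ->
        (size (genH k a l r b c))%:R <= (polyH k)`_(l - a)`_(b - r.+1)].
Proof.
elim: k => [|k [IHF IHW IHH]].
  by rewrite /polyF /polyW /polyH /=; split=> *; rewrite !coef0.
have IHP a l r b c : (a <= l)%N -> (r < b)%N ->
    (size (gen_phase (genW k) (genH k) a l r b c))%:R
      <= (polyH k + (polyW k)%:P)`_(l - a)`_(b - r.+1).
  move=> al rb; rewrite /gen_phase coefD coefC coefD subn_eq0.
  have [<-|ne] := eqVneq a l; first by rewrite leqnn subnn polyH0 coef0 add0r IHW.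
  have alt : (a < l)%N by rewrite ltn_neqAle ne.
  by rewrite leqNgt alt /= coef0 addr0 IHH.
split.
- move=> a b ab; rewrite polyFS -addrA coefD coef1 coefD !coefXM /= subn_eq0.
  have [->|ne] := eqVneq a b; first by rewrite leqnn /= !addr0.
  have abt : (a < b)%N by rewrite ltn_neqAle ne.
  rewrite leqNgt abt /= add0r size_cat natrD -subnS.
  apply: lerD; first exact: IHF.
  (* The smaller endpoint of the block splits the other [b - a - 1] points into two sides;
     evaluation at ['X] sums over the possible splits. *)
  rewrite hornerX_coef2 -{1}(subnSK abt).
  apply: (size_flatten_iota (g := fun i => (polyH k + (polyW k)%:P)`_i`_(b - a.+1 - i))) => j hj.
  have := @IHP a (a + j)%N (a + j)%N b (a + j)%N.
  have -> : (a + j - a = j)%N by lia.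
  have -> : (b - (a + j).+1 = b - a.+1 - j)%N by lia.
  by apply; lia.
- move=> r l c rl; rewrite polyWS !coefD !coefXM /=.
  rewrite size_cat natrD; apply: lerD.
    case: ltnP => h; last by rewrite (_ : l - r.+1 = 0)%N ?addr0 //; lia.
    rewrite subn_eq0 leqNgt h /= size_cat !size_map natrD -subnS.
    by apply: lerD; [apply: IHF | apply: IHW].
  case: (posnP (l - r.+1)%N) => [->|h] //=.
  rewrite coefMr -{1}(prednK h).
  apply: (size_flatten_iota (g := fun i => (polyF k)`_((l - r.+1).-1 - i) * (polyW k)`_i)) => j hj.
  rewrite size_allpairs natrM; apply: ler_pM => //.
    have -> : ((l - r.+1).-1 - j = l - (r.+1 + j).+1)%N by lia.
    by apply: IHF; lia.
  have := IHW r (r.+1 + j)%N (r.+1 + j)%N.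
  have -> : (r.+1 + j - r.+1 = j)%N by lia.
  by apply; lia.
- move=> a l r b c al rb; rewrite polyHS !coefD coefCM !coefXM.
  rewrite [(l - a)%N == _]subn_eq0 [(l <= a)%N]leqNgt al /= size_cat natrD; apply: lerD.
    case: ltnP => h; last by rewrite (_ : b - r.+1 = 0)%N //; lia.
    rewrite subn_eq0 leqNgt h /= size_map -subnS.
    exact: IHH.
  have h : (0 < l - a)%N by lia.
  rewrite coefMr coef_sum -{1}(prednK h).
  apply: (size_flatten_iota (g := fun i =>
    ((map_poly polyC (polyF k))`_((l - a).-1 - i)
      * (polyH k + (polyW k)%:P)`_i)`_(b - r.+1))) => j hj.
  rewrite coef_map_id0 // coefCM size_allpairs natrM; apply: ler_pM => //.
    have -> : ((l - a).-1 - j = l - (a + j).+1)%N by lia.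
    by apply: IHF; lia.
  have := @IHP a (a + j)%N r b (a + j)%N.
  have -> : (a + j - a = j)%N by lia.
  by apply; lia.
Qed.

(* The hypotheses say that [(F, W, H)] is a super-solution, at [z], of the system
   satisfied by the generating functions. *)
Lemma gpoly_bounds (z F W H : R) : 0 <= z -> 0 <= F -> 0 <= W -> 0 <= H ->
  1 + z * F + z * (H + W) <= F ->
  z * F + z * W + z * (F * W) <= W ->
  z * H + z * (F * (H + W)) <= H ->
  forall k, [/\ 0 <= (polyF k).[z] <= F, 0 <= (polyW k).[z] <= W & 0 <= (diagH k).[z] <= H].
Proof.
move=> z0 F0 W0 H0 hF hW hH; elim=> [|k [/andP[f0 f1] /andP[w0 w1] /andP[h0 h1]]].
  by rewrite /polyF /polyW /diagH /polyH /= !horner0 lexx F0 W0 H0.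
rewrite polyFS polyWS diagHS diagH_phase -polyC1 !(hornerD, hornerM, hornerX, hornerC).
split; apply/andP; split; rewrite ?(addr_ge0, mulr_ge0, ler01) //.
- apply: le_trans hF; apply: lerD; [apply: lerD => // |]; apply: ler_wpM2l => //.
  exact: lerD.
- apply: le_trans hW; apply: lerD; [apply: lerD |]; apply: ler_wpM2l => //.
  exact: ler_pM.
- apply: le_trans hH; apply: lerD; apply: ler_wpM2l => //.
  by apply: ler_pM; rewrite ?addr_ge0 // lerD.
Qed.

(** All iterates stay below the super-solution at [z], and since their coefficients are nonnegative,
    the single term of degree [n] is at most the whole value. *)
Lemma size_genF_bound (z F W H : R) : 0 < z -> 0 <= F -> 0 <= W -> 0 <= H ->
  1 + z * F + z * (H + W) <= F ->
  z * F + z * W + z * (F * W) <= W ->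
  z * H + z * (F * (H + W)) <= H ->
  forall k n, (size (genF k 0 n))%:R <= F * z^-1 ^+ n.
Proof.
move=> z0 F0 W0 H0 hF hW hH k n.
rewrite exprVn -ler_pdivrMr ?invr_gt0 ?exprn_gt0 // invrK.
have [/andP[_ le_F] _ _] := gpoly_bounds (ltW z0) F0 W0 H0 hF hW hH k.
have nnF i : 0 <= (polyF k)`_i by have [] := gpoly_nneg k i.
apply: le_trans le_F; have [szF _ _] := size_gen k.
apply: (@le_trans _ _ ((polyF k)`_n * z ^+ n)).
  by rewrite ler_pM2r ?exprn_gt0 //; have := szF 0 n (leq0n n); rewrite subn0.
rewrite (@horner_coef_wide _ (maxn n.+1 (size (polyF k)))) ?leq_maxr //.
have lt_n : (n < maxn n.+1 (size (polyF k)))%N by lia.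
rewrite (bigD1 (Ordinal lt_n)) //= lerDl sumr_ge0 // => i _.
by rewrite mulr_ge0 ?exprn_ge0 // ltW.
Qed.
End GeneratingPolynomials.

Local Open Scope nat_scope.

(** * Decomposition of an ordered partition *)

Definition consec (T : eqType) (s : seq T) x y := (x, y) \in zip s (behead s).

Lemma consecP (T : eqType) (s : seq T) x y :
  reflect (exists s1 s2, s = s1 ++ x :: y :: s2) (consec s x y).
Proof.
apply: (iffP idP) => [|[s1 [s2 ->]]]; last first.
  rewrite /consec; elim: s1 => [|a [|b s1] IHs] /=; rewrite in_cons ?eqxx //.
    by rewrite inE eqxx orbT.
  by rewrite IHs orbT.
rewrite /consec; elim: s => [|a [|b s] IHs] //=; rewrite in_cons => /orP[/eqP[-> ->]|/IHs].
  by exists [::], s.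
by move=> [s1 [s2 ->]]; exists (a :: s1), s2.
Qed.

Lemma consec_rev (T : eqType) (s : seq T) x y : consec (rev s) x y = consec s y x.
Proof.
have imp (t : seq T) u v : consec t u v -> consec (rev t) v u.
  move=> /consecP[s1 [s2 ->]]; apply/consecP; exists (rev s2), (rev s1).
  by rewrite rev_cat !rev_cons !cat_rcons.
by apply/idP/idP => /imp; rewrite ?revK.
Qed.

Lemma uniq_cat_inj (T : eqType) (s1 s2 t1 t2 : seq T) x :
  uniq (s1 ++ x :: s2) -> s1 ++ x :: s2 = t1 ++ x :: t2 -> s1 = t1 /\ s2 = t2.
Proof.
move=> us e; have ut : uniq (t1 ++ x :: t2) by rewrite -e.
have idx (r1 r2 : seq T) : uniq (r1 ++ x :: r2) -> index x (r1 ++ x :: r2) = size r1.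
  rewrite cat_uniq /= => /and3P[_ /norP[xr _] _].
  by rewrite index_cat (negPf xr) /= eqxx addn0.
have sz : size s1 = size t1 by rewrite -(idx s1 s2) // e idx.
have /eqP := e; rewrite eqseq_cat // => /andP[/eqP -> /eqP[->]]; split=> //.
Qed.

Section Decomposition.
(** The geometry enters only through these hypotheses: edges become a symmetric relation on indices,
    and crossings become interleaved pairs. A block may be listed from either end, hence the closure
    of [comp] under reversal. *)
Variables (n : nat) (adj : rel nat) (comp : seq nat -> Prop).
Hypothesis adjC : symmetric adj.
Hypothesis adj_noncrossing : forall a b c d,
  a < b -> b < c -> c < d -> adj a c -> adj b d -> False.
Hypothesis comp_uniq : forall s, comp s -> uniq s.
Hypothesis comp_adj : forall s x y, comp s -> consec s x y -> adj x y.
Hypothesis adj_comp : forall s x y, comp s -> x \in s -> adj x y ->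
  consec s x y || consec s y x.
Hypothesis comp_rev : forall s, comp s -> comp (rev s).
Hypothesis comp_cover : forall x, x < n -> exists s, comp s /\ x \in s.
Hypothesis comp_ordered : forall i s y t, comp (i :: s) -> comp (y :: t) ->
  (forall x, x \in y :: t -> x \notin i :: s) -> i < y < last i s -> False.

(** * Walks along a block and closed regions *)

Lemma adj_path s s1 x s2 : comp s -> s = s1 ++ x :: s2 ->
  (forall y, adj x y -> (exists s1', s1 = rcons s1' y) \/ (exists s2', s2 = y :: s2')).
Proof.
move=> cs es y xy; have us := comp_uniq cs; rewrite es in us.
have xs : x \in s by rewrite es mem_cat inE eqxx orbT.
case/orP: (adj_comp cs xs xy) => /consecP[t1 [t2 et]].
  by right; exists t2; have [] := uniq_cat_inj us (etrans (esym es) et).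
left; exists t1; move: et; rewrite -cat_rcons => et.
by have [] := uniq_cat_inj us (etrans (esym es) et).
Qed.

Lemma suffix_path s s1 x s2 : comp s -> s = s1 ++ x :: s2 -> path adj x s2.
Proof.
move=> cs; elim: s2 s1 x => [|y s2 IHs] //= s1 x es.
rewrite (comp_adj cs) /=; last by apply/consecP; exists s1, s2.
by apply: (IHs (rcons s1 x)); rewrite cat_rcons.
Qed.

(** Closure of [G] is asked only along edges towards vertices still ahead. If [G] can be left only
    through an earlier vertex of the path, uniqueness therefore keeps the walk inside. *)
Lemma walk_in (G : pred nat) y s : path adj y s -> G y ->
  (forall u v, G u -> v \in s -> adj u v -> G v) -> {in y :: s, forall v, G v}.
Proof.
elim: s y => [|z s IHs] y /=; first by move=> _ Gy _ v; rewrite inE => /eqP->.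
move=> /andP[yz pz] Gy h v; rewrite in_cons => /orP[/eqP-> //|].
apply: IHs => //; first by apply: h yz; rewrite ?mem_head.
by move=> u w Gu ws; apply: h => //; rewrite in_cons ws orbT.
Qed.

Definition adj_closed (G : pred nat) := forall u v, G u -> adj u v -> G v.

(** From [x] the path is followed forwards to its end and, after reversal, backwards to its
    start. *)
Lemma comp_in_closed (G : pred nat) s x : adj_closed G -> comp s -> x \in s -> G x ->
  {in s, forall v, G v}.
Proof.
move=> clG cs xs Gx.
have [s1 [s2 es]] : exists s1 s2, s = s1 ++ x :: s2.
  by case/splitPr: xs => s1 s2; exists s1, s2.
have half t t1 t2 : comp t -> t = t1 ++ x :: t2 -> {in x :: t2, forall v, G v}.
  move=> ct et; apply: walk_in => //; first exact: suffix_path ct et.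
  by move=> u v Gu _; apply: clG.
move=> v; rewrite es mem_cat => /orP[vs1|vs2]; last exact: half _ _ _ cs es _ vs2.
apply: (half (rev s) (rev s2) (rev s1)); first exact: comp_rev.
  by rewrite es rev_cat rev_cons cat_rcons.
by rewrite in_cons mem_rev vs1 orbT.
Qed.

(* A block living strictly inside the gap would have an endpoint there. *)
Lemma gap_empty i s lo hi : comp (i :: s) -> adj_closed (fun y => lo < y < hi) ->
  i <= lo -> hi <= last i s -> hi <= n -> hi <= lo.+1.
Proof.
move=> cs clG ilo hij hin; rewrite leqNgt; apply/negP => h.
have [t [ct yt]] : exists t, comp t /\ lo.+1 \in t by apply: comp_cover; lia.
have tG : {in t, forall v, lo < v < hi} by apply: (comp_in_closed clG ct yt); lia.
case: t ct yt tG => [|y t] ct yt tG //.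
have Gy : lo < y < hi by apply: tG; rewrite mem_head.
apply: (comp_ordered cs ct); last lia.
(* The two blocks are disjoint: a common vertex would draw [i] into the gap, against [i <= lo]. *)
move=> x xt; apply/negP => xs.
by have := comp_in_closed clG cs xs (tG _ xt) (mem_head i s); lia.
Qed.

(** * Edge lists representing a set of points *)

Definition represents (U : pred nat) (el : edge_list) := forall x y,
  adj x y && (U x || U y) = ((x, y) \in el) || ((y, x) \in el).

Lemma represents_eq (U V : pred nat) el : U =1 V -> represents U el -> represents V el.
Proof. by move=> eUV h x y; rewrite -!eUV h. Qed.

Lemma represents_nil (U : pred nat) : U =1 xpred0 -> represents U [::].
Proof. by move=> h x y; rewrite !h andbF. Qed.

Lemma represents_cat (U V : pred nat) e1 e2 : represents U e1 -> represents V e2 ->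
  represents (fun x => U x || V x) (e1 ++ e2).
Proof.
move=> h1 h2 x y; rewrite !mem_cat.
by rewrite [RHS]orbACA -h1 -h2 -andb_orr orbACA.
Qed.

(** This serves isolated vertices and the starting endpoint of a block: every edge at [x] already
    touches [U], so adding [x] brings no new edge. *)
Lemma represents_add (U : pred nat) x e : represents U e -> (forall y, adj x y -> U y) ->
  represents (fun y => U y || (y == x)) e.
Proof.
move=> h hx u v; rewrite -h; case uv: (adj u v) => //=.
have [eu|] := eqVneq u x; first by rewrite !(hx v) -?eu // !orbT.
have [ev|] := eqVneq v x; last by rewrite !orbF.
by rewrite !(hx u) -?ev 1?adjC.
Qed.

(** An edge is charged to a set as soon as one end lies in it. Hence adding [x] to [U] contributes
    at most the edge by which [x] is reached from [c]. *)
Lemma represents_cons (U : pred nat) c x e : represents U e -> adj c x ->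
  (forall y, adj x y -> y = c \/ U y) ->
  represents (fun y => U y || (y == x)) ((c, x) :: e).
Proof.
move=> h cx hx u v; rewrite !in_cons !xpair_eqE [RHS]orbACA -h.
case uv: (adj u v) => /=; last first.
  rewrite orbF; apply/esym/negP => /orP[]/andP[/eqP eu /eqP ev].
    by rewrite -eu -ev uv in cx.
  by rewrite -eu -ev adjC uv in cx.
have [eu|nu] := eqVneq u x.
  have xv : adj x v by rewrite -eu.
  by case: (hx v xv) => ->; rewrite ?eqxx ?orbT.
have [ev|nv] := eqVneq v x; last by rewrite !orbF !andbF.
have xu : adj x u by rewrite -ev adjC.
by case: (hx u xu) => ->; rewrite ?eqxx ?orbT.
Qed.

Lemma next_adj s pre c x rest : comp s -> s = pre ++ c :: x :: rest ->
  forall y, adj x y -> y = c \/ exists rest', rest = y :: rest'.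
Proof.
move=> cs es y /(adj_path cs (s1 := rcons pre c) (s2 := rest)).
rewrite cat_rcons => /(_ es) [[s1' /rcons_inj[_ ->]]|]; by [left | right].
Qed.

(** * Completeness of the grammar *)

Definition F_complete k := forall a b, a <= b <= n -> b - a < k ->
  adj_closed (fun y => a <= y < b) ->
  exists2 e, e \in genF k a b & represents (fun y => a <= y < b) e.

(** The vertices [pre] and [c] have been visited and [x] comes next; edges leave the interval only
    along [x -- c]. As in the other two statements, the fuel exceeds the number of points left, here
    [l - r - 1]. *)
Definition W_complete k := forall i s pre c x rest r l,
  comp (i :: s) -> i :: s = pre ++ c :: x :: rest ->
  i <= r -> l <= n -> (c <= r) || (l <= c) -> l - r <= k ->
  {in x :: rest, forall y, r < y < l} ->
  (forall u v, r < u < l -> adj u v -> r < v < l \/ (u = x /\ v = c)) ->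
  exists2 e, e \in genW k r l c & represents (fun y => r < y < l) e.

(** The arc [[l, r]] is dealt with and contains the smaller endpoint [i]; the larger endpoint lies
    to its right, and the least point [a] is still ahead on the path. *)
Definition H_complete k := forall i s pre c x rest a l r b,
  comp (i :: s) -> i :: s = pre ++ c :: x :: rest ->
  a < l -> l <= i <= r -> l <= c <= r -> r < b <= n -> r < last i s ->
  (l - a) + (b - r) <= k -> a \in x :: rest ->
  {in x :: rest, forall y, (a <= y < l) || (r < y < b)} ->
  (forall u v, (a <= u < l) || (r < u < b) -> adj u v ->
     (a <= v < l) || (r < v < b) \/ (u = x /\ v = c)) ->
  exists2 e, e \in genH k a l r b c &
             represents (fun y => (a <= y < l) || (r < y < b)) e.

(** The edge [c -- x] cuts the interval at [x] into two halves not joined by any edge, and the rest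
    of the path stays in one of them. If it does not enter [(r, x)], this half lies between the
    endpoints and is empty by [gap_empty]; if it does not enter [(x, l)], that half carries an
    independent partition. *)
Lemma W_completeS k : F_complete k -> W_complete k -> W_complete k.+1.
Proof.
move=> IHF IHW i s pre c x rest r l cs es ir ln cU lrk inU clU.
have us : uniq (pre ++ c :: x :: rest) by rewrite -es comp_uniq.
have ej : last i s = last x rest by rewrite -[LHS]/(last i (i :: s)) es last_cat.
have xU : r < x < l by rewrite inU ?mem_head.
have cx : adj c x by apply: (comp_adj cs); apply/consecP; exists pre, rest.
have nx := next_adj cs es.
have px : path adj x rest by apply: (suffix_path cs (s1 := rcons pre c)); rewrite cat_rcons.
have xrest : x \notin rest.
  by move: us; rewrite cat_uniq /= => /and3P[_ _ /and3P[_ ->]].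
(* The vertex [c] is outside the open interval; on whichever side it lies, an edge passing over [x]
   would cross [c -- x]. *)
have sep y v : r < y < x -> x < v < l -> ~~ adj y v.
  move=> hy hv; apply/negP => yv; case/orP: cU => hc.
    by apply: (@adj_noncrossing c y x v) => //; lia.
  by apply: (@adj_noncrossing y x v c) => //; rewrite 1?adjC //; lia.
have left_cl u v : r < u < x -> adj u v -> r < v < x \/ v = x.
  move=> hu uv; case: (clU u v _ uv); first lia; last by lia.
  move=> hv; have [?|?|?] := ltngtP v x; [left; lia | | by right].
  by have := sep u v hu; rewrite uv => h; have := h ltac:(lia).
have right_cl u v : x < u < l -> adj u v -> x < v < l \/ v = x.
  move=> hu uv; case: (clU u v _ uv); first lia; last by lia.
  move=> hv; have [?|?|?] := ltngtP v x; [ | left; lia | by right].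
  by have := sep v u; rewrite adjC uv => h; have := h ltac:(lia) ltac:(lia).
have [e0|[y0 [rest0 e0]]] : rest = [::] \/ exists y0 rest0, rest = y0 :: rest0.
  by case: (rest) => [|y0 rest0]; [left | right; exists y0, rest0].
- subst rest; rewrite /= in ej.
  have xcl u : adj x u -> u = c by move=> /nx [//|[? //]].
  have clL : adj_closed (fun y => r < y < x).
    move=> u v hu uv; case: (left_cl u v hu uv) => // ev.
    by have := xcl u; rewrite adjC -ev uv => /(_ isT); lia.
  have clR : adj_closed (fun y => x < y < l).
    move=> u v hu uv; case: (right_cl u v hu uv) => // ev.
    by have := xcl u; rewrite adjC -ev uv => /(_ isT); lia.
  have ex : x = r.+1.
    by have := gap_empty cs clL ir; rewrite ej leqnn => /(_ isT); lia.
  clear ej; subst x.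
  have [||e he re] := IHF r.+2 l _ _ clR; [lia | lia |].
  exists ((c, r.+1) :: e).
    rewrite /= (_ : r.+1 < l); last lia.
    by rewrite !mem_cat map_f.
  apply: represents_eq (represents_cons re cx _) => [y|y /xcl ->]; [lia | by left].
subst rest.
have y0U : r < y0 < l by apply: inU; rewrite !inE eqxx orbT.
have y0x : y0 != x by move: xrest; rewrite in_cons negb_or eq_sym => /andP[].
have [py0 xy0] : path adj y0 rest0 /\ adj x y0 by case/andP: px.
have xnb u : adj x u -> u = c \/ u = y0.
  by move=> /nx [->|[? [->]]]; [left | right].
have [hy|hy] := ltnP x y0.
(* The path goes on to the right of [x], so the larger endpoint is beyond [x] and the gap [(r, x)]
   must be empty. *)
- have stay : {in y0 :: rest0, forall v, x < v < l}.
    apply: walk_in py0 _ _; first lia.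
    move=> u v hu vr uv; case: (right_cl u v hu uv) => // ev.
    by move: xrest; rewrite -ev in_cons vr orbT.
  have clL : adj_closed (fun y => r < y < x).
    move=> u v hu uv; case: (left_cl u v hu uv) => // ev.
    by case: (xnb u); [rewrite adjC -ev | lia | lia].
  have jR : x < last i s < l by rewrite ej; apply: stay; rewrite /= mem_last.
  have ex : x = r.+1 by have := gap_empty cs clL ir; lia.
  subst x.
  have [|||||||e he re] := IHW i s (rcons pre c) r.+1 y0 rest0 r.+1 l cs.
  + by rewrite cat_rcons.
  + lia.
  + lia.
  + lia.
  + lia.
  + exact: stay.
  + move=> u v hu uv; case: (right_cl u v hu uv) => [|ev]; [by left | right].
    by case: (xnb u); [rewrite adjC -ev | lia | ].
  exists ((c, r.+1) :: e).
    rewrite /= (_ : r.+1 < l); last lia.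
    by rewrite 2!mem_cat (map_f _ he) orbT.
  apply: represents_eq (represents_cons re cx _) => [y|y /xnb[->|->]]; 
    [lia | by left | by right; lia].
(* Here the larger endpoint lies in [(r, x)], so [(x, l)] is not between the endpoints and may
   contain blocks of its own. *)
have stay : {in y0 :: rest0, forall v, r < v < x}.
  apply: walk_in py0 _ _; first lia.
  move=> u v hu vr uv; case: (left_cl u v hu uv) => // ev.
  by move: xrest; rewrite -ev in_cons vr orbT.
have clR : adj_closed (fun y => x < y < l).
  move=> u v hu uv; case: (right_cl u v hu uv) => // ev.
  by case: (xnb u); [rewrite adjC -ev | lia | lia].
have [||e1 he1 re1] := IHF x.+1 l _ _ clR; [lia | lia |].
have [|||||||e2 he2 re2] := IHW i s (rcons pre c) x y0 rest0 r x cs.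
- by rewrite cat_rcons.
- lia.
- lia.
- lia.
- lia.
- exact: stay.
- move=> u v hu uv; case: (left_cl u v hu uv) => [|ev]; [by left | right].
  by case: (xnb u); [rewrite adjC -ev | lia | ].
exists ((c, x) :: e1 ++ e2).
  rewrite /= mem_cat; apply/orP; right; apply/flattenP.
  exists [seq (c, x) :: f1 ++ f2 | f1 <- genF k x.+1 l, f2 <- genW k r x x].
    by apply/mapP; exists x; rewrite // mem_iota; lia.
  by apply/allpairsP; exists (e1, e2).
apply: represents_eq (represents_cons (represents_cat re1 re2) cx _) => [y|y /xnb[->|->]].
- lia.
- by left.
- by right; rewrite /=; lia.
Qed.

(** The edge [c -- x] cuts off the points between the arc and [x]. The path must still reach the
    opposite side, namely the larger endpoint if [x] is on the left and [a] if [x] is on the right,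
    so it cannot enter this gap. A gap on the right lies between the endpoints and is empty. *)
Lemma H_completeS k : F_complete k -> W_complete k -> H_complete k -> H_complete k.+1.
Proof.
move=> IHF IHW IHH i s pre c x rest a l r b cs es al lir lcr rbn rj abk ax inU clU.
have us : uniq (pre ++ c :: x :: rest) by rewrite -es comp_uniq.
have ej : last i s = last x rest by rewrite -[LHS]/(last i (i :: s)) es last_cat.
have xU : (a <= x < l) || (r < x < b) by rewrite inU ?mem_head.
have cx : adj c x by apply: (comp_adj cs); apply/consecP; exists pre, rest.
have nx := next_adj cs es.
have px : path adj x rest by apply: (suffix_path cs (s1 := rcons pre c)); rewrite cat_rcons.
have xrest : x \notin rest.
  by move: us; rewrite cat_uniq /= => /and3P[_ _ /and3P[_ ->]].
have inS y : y \in rest -> y \in i :: s by move=> yr; rewrite es mem_cat !inE yr !orbT.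
have es' : i :: s = rcons pre c ++ x :: rest by rewrite cat_rcons.
(* A walk leaving [x] into a region [G] bounded by the edge [c -- x] is trapped there. *)
have trap (G : pred nat) z : (forall u v, G u -> adj u v -> G v \/ v = x) -> ~~ G c ->
    z \in rest -> ~~ G z -> adj_closed G.
  move=> hG Gc zr Gz u v Gu uv; case: (hG u v Gu uv) => // ev.
  case: (nx u); first by rewrite -ev adjC.
    by move=> eu; rewrite -eu Gu in Gc.
  move=> [rest' er]; move: px; rewrite er /= => /andP[_ pu].
  have stay : {in u :: rest', forall w, G w}.
    apply: walk_in pu Gu _ => y w Gy wr yw; case: (hG y w Gy yw) => // ew.
    by move: xrest; rewrite er -ew in_cons wr orbT.
  by have := stay z; rewrite -er zr (negPf Gz) => /(_ isT).
have avoid (G : pred nat) : adj_closed G -> ~~ G i -> {in i :: s, forall y, ~~ G y}.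
  move=> clG Gi y ys; apply: contra Gi => Gy.
  by apply: (comp_in_closed clG cs ys Gy); rewrite mem_head.
have jin : last i s \in x :: rest by rewrite ej mem_last.
have [xl|xr] : x < l \/ r < x by lia.
- have jrest : last i s \in rest by move: jin; rewrite in_cons => /orP[/eqP|//]; lia.
  have clG : adj_closed (fun y => x < y < l).
    apply: (trap _ (last i s)) => //; [|lia|lia].
    move=> u v hu uv; case: (clU u v _ uv); [lia | | lia] => hv.
    have [h|h|h] := ltngtP v x; [| | by right].
      by case: (@adj_noncrossing v x u c) => //; rewrite 1?adjC //; lia.
    have [h'|h'] := ltnP v l; first by left; lia.
    by case: (@adj_noncrossing x u c v) => //; rewrite 1?adjC //; lia.
  have avG := avoid _ clG ltac:(lia).
  have [y0 [rest0 e0]] : exists y0 rest0, rest = y0 :: rest0.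
    by case: (rest) jrest => [|y0 rest0] // _; exists y0, rest0.
  have inU' : {in rest, forall y, (a <= y < x) || (r < y < b)}.
    move=> y yr; have := avG y (inS y yr).
    have : y != x by apply: contraNneq xrest => <-.
    have := inU y; rewrite in_cons yr orbT => /(_ isT); lia.
  have clU' u v : (a <= u < x) || (r < u < b) -> adj u v ->
      (a <= v < x) || (r < v < b) \/ (u = y0 /\ v = x).
    move=> hu uv; case: (clU u v _ uv); [lia | | lia] => hv.
    have [ev|nv] := eqVneq v x.
      right; split=> //; case: (nx u); first by rewrite -ev adjC.
        by move=> eu; lia.
      by rewrite e0 => -[rest' [->]].
    have := clG v u; rewrite adjC => h.
    left; case hvG : (x < v < l); last lia.
    by have := h hvG uv; lia.
  have [||e1 he1 re1] := IHF x.+1 l _ _ clG; [lia | lia |].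
  have [e2 he2 re2] : exists2 e, e \in gen_phase (genW k) (genH k) a x r b x
      & represents (fun y => (a <= y < x) || (r < y < b)) e.
    (* If [x] is the least point, the left side is exhausted and the walk passes to the phase
       [genW]. *)
    rewrite /gen_phase; have [eax|ne] := eqVneq a x.
      subst x rest; have [||||||e he re] := IHW i s (rcons pre c) a y0 rest0 r b cs es'.
      - lia.
      - lia.
      - lia.
      - lia.
      - by move=> y /inU'; lia.
      - by move=> u v hu uv; case: (clU' u v _ uv); [lia | left; lia | right].
      by exists e => //; apply: represents_eq re => y; lia.
    subst rest; apply: (IHH i s (rcons pre c) x y0 rest0) => //; try lia.
    by move: ax; rewrite in_cons (negPf ne).
  exists ((c, x) :: e1 ++ e2).
    rewrite /= mem_cat; apply/orP; right; apply/flattenP.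
    exists [seq (c, x) :: f1 ++ f2 | f1 <- genF k x.+1 l,
                                      f2 <- gen_phase (genW k) (genH k) a x r b x].
      by apply/mapP; exists x; rewrite // mem_iota; lia.
    by apply/allpairsP; exists (e1, e2).
  apply: represents_eq (represents_cons (represents_cat re1 re2) cx _) => [y|y /nx[->|[r' er]]].
  + lia.
  + by left.
  + by right; have := inU' y; rewrite er mem_head => /(_ isT) ->; rewrite orbT.
have arest : a \in rest by move: ax; rewrite in_cons => /orP[/eqP|//]; lia.
have clG : adj_closed (fun y => r < y < x).
  apply: (trap _ a) => //; [|lia|lia].
  move=> u v hu uv; case: (clU u v _ uv); [lia | | lia] => hv.
  have [h|h|h] := ltngtP v x; [| | by right].
    have [h'|h'] := ltnP r v; first by left; lia.
    by case: (@adj_noncrossing v c u x) => //; rewrite 1?adjC //; lia.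
  by case: (@adj_noncrossing c u x v) => //; lia.
have avG := avoid _ clG ltac:(lia).
have [y0 [rest0 e0]] : exists y0 rest0, rest = y0 :: rest0.
  by case: (rest) arest => [|y0 rest0] // _; exists y0, rest0.
(* The path does not end at [x], as [a] is still ahead; so the larger endpoint stays strictly to the
   right of the extended arc, as [H_complete] demands. *)
have jx : last i s != x.
  by rewrite ej e0 /=; apply: contraNneq xrest => <-; rewrite e0 mem_last.
have ex : x = r.+1.
  have := avG (last i s); rewrite es mem_cat in_cons jin !orbT => /(_ isT) h.
  by have := gap_empty cs clG ltac:(lia); lia.
have inU' : {in rest, forall y, (a <= y < l) || (x < y < b)}.
  move=> y yr; have : y != x by apply: contraNneq xrest => <-.
  by have := inU y; rewrite in_cons yr orbT => /(_ isT); lia.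
have clU' u v : (a <= u < l) || (x < u < b) -> adj u v ->
    (a <= v < l) || (x < v < b) \/ (u = y0 /\ v = x).
  move=> hu uv; case: (clU u v _ uv); [lia | | lia] => hv.
  have [ev|nv] := eqVneq v x; last by left; lia.
  right; split=> //; case: (nx u); first by rewrite -ev adjC.
    by move=> eu; lia.
  by rewrite e0 => -[rest' [->]].
have [e he re] : exists2 e, e \in genH k a l x b x &
    represents (fun y => (a <= y < l) || (x < y < b)) e.
  by subst rest; apply: (IHH i s (rcons pre c) x y0 rest0) => //; lia.
exists ((c, x) :: e).
  rewrite ex in he *; rewrite /= (_ : r.+1 < b); last lia.
  by rewrite mem_cat (map_f _ he).
apply: represents_eq (represents_cons re cx _) => [y|y /nx[->|[r' er]]].
- lia.
- by left.
- by right; apply: inU'; rewrite er mem_head.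
Qed.

(** The block of the least point [a] is a singleton or is walked from its smaller endpoint [i]. In
    the latter case the arc starts as [[i, i]], and the remaining points are those on its two
    sides. *)
Lemma F_completeS k : F_complete k -> W_complete k -> H_complete k -> F_complete k.+1.
Proof.
move=> IHF IHW IHH a b abn abk clU.
have [eab|ne] := eqVneq a b.
  exists [::]; first by rewrite /= eab eqxx inE.
  by apply: represents_nil => y; lia.
have ab : a < b by lia.
have [s [cs as_]] : exists s, comp s /\ a \in s by apply: comp_cover; lia.
(* Reversal puts the smaller endpoint in front; equal endpoints of a longer path would repeat a
   vertex. *)
have [e0|[i [x [rest [cs' ain lij]]]]] : s = [:: a] \/ exists i x rest,
    [/\ comp (i :: x :: rest), a \in i :: x :: rest & i < last x rest].
  case: s cs as_ => [|i [|x rest]] // cs as_.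
    by left; move: as_; rewrite inE => /eqP ->.
  right; have [h|h|h] := ltngtP i (last x rest).
  - by exists i, x, rest.
  - have h1 : last 0 (rev (i :: x :: rest)) = i by rewrite rev_cons last_rcons.
    have h2 : head 0 (rev (i :: x :: rest)) = last x rest by rewrite lastI rev_rcons.
    have h3 : size (rev (i :: x :: rest)) = (size rest).+2 by rewrite size_rev.
    have h4 : a \in rev (i :: x :: rest) by rewrite mem_rev.
    case: (rev _) (comp_rev cs) h1 h2 h3 h4 => [|i' [|x' rest']] //= cr e1 e2 _ h4.
    by exists i', x', rest'; split=> //; rewrite e1 e2.
  - by have := comp_uniq cs; rewrite /= h mem_last.
- subst s.
  have iso v : adj a v -> False.
    by move=> /(adj_path cs (s1 := [::]) (s2 := [::]) erefl) [[[|? ?] //]|[]].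
  have [|||e he re] := IHF a.+1 b; [lia | lia | |].
    move=> u v hu uv; have := clU u v ltac:(lia) uv.
    have [ev|] := eqVneq v a; last by lia.
    by case: (iso u); rewrite -ev adjC.
  exists e; first by rewrite /= (negPf ne) mem_cat he.
  by apply: represents_eq (represents_add re _) => [y|y /iso //]; lia.
have sU : {in i :: x :: rest, forall y, a <= y < b}.
  by apply: (comp_in_closed clU cs' ain); lia.
have us := comp_uniq cs'.
have iU := sU i (mem_head _ _).
have ix : i \notin x :: rest by case/andP: us.
have tU y : y \in x :: rest -> (a <= y < i) || (i < y < b).
  move=> hy; have : y != i by apply: contraNneq ix => <-.
  by have := sU y; rewrite in_cons hy orbT => /(_ isT); lia.
have nbi v : adj i v -> v = x.
  by move=> /(adj_path cs' (s1 := [::]) (s2 := x :: rest) erefl)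
    [[[|? ?] //]|[? [->]]].
have clU' u v : (a <= u < i) || (i < u < b) -> adj u v ->
    (a <= v < i) || (i < v < b) \/ (u = x /\ v = i).
  move=> hu uv; have := clU u v ltac:(lia) uv.
  have [ev|] := eqVneq v i; last by left; lia.
  by right; split=> //; apply: nbi; rewrite -ev adjC.
have [e he re] : exists2 e, e \in gen_phase (genW k) (genH k) a i i b i
    & represents (fun y => (a <= y < i) || (i < y < b)) e.
  rewrite /gen_phase; have [eai|nai] := eqVneq a i.
    subst a; have [||||||e he re] := IHW i (x :: rest) [::] i x rest i b cs' erefl.
    - lia.
    - lia.
    - lia.
    - lia.
    - by move=> y /tU; lia.
    - by move=> u v hu uv; case: (clU' u v _ uv); [lia | left; lia | right].
    by exists e => //; apply: represents_eq re => y; lia.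
  apply: (IHH i (x :: rest) [::] i x rest) => //; try lia.
  by move: ain; rewrite in_cons (negPf nai).
exists e.
  rewrite /= (negPf ne) mem_cat; apply/orP; right; apply/flattenP.
  exists (gen_phase (genW k) (genH k) a i i b i) => //.
  by apply/mapP; exists i; rewrite // mem_iota; lia.
apply: represents_eq (represents_add (x := i) re _) => [y|y /nbi ->]; first by lia.
by apply: tU; rewrite mem_head.
Qed.

Lemma gen_complete k : [/\ F_complete k, W_complete k & H_complete k].
Proof.
elim: k => [|k [IHF IHW IHH]]; last first.
  by split; [exact: F_completeS | exact: W_completeS | exact: H_completeS].
split=> //.
- move=> i s pre c x rest r l _ _ _ _ _ lr inU.
  by have := inU x (mem_head _ _); lia.
- by move=> i s pre c x rest a l r b _ _; lia.
Qed.

Lemma comp_edges_listed : (forall x y, adj x y -> (x < n) && (y < n)) ->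
  exists2 e, e \in genF n.+1 0 n &
    forall x y, adj x y = ((x, y) \in e) || ((y, x) \in e).
Proof.
move=> supp; have [hF _ _] := gen_complete n.+1.
have [|||e he re] := hF 0 n; [lia | lia | |].
  by move=> u v _ /supp; lia.
exists e => // x y; rewrite -re; case xy: (adj x y) => //=.
by have /andP[-> _] := supp _ _ xy.
Qed.

End Decomposition.

Local Open Scope ring_scope.

(** * From the plane to the index set *)

(** By Cramer's rule the two lines meet at parameters [orient a b d / D] and [orient a b c / D],
    where [D] is twice the signed area of the quadrilateral. Each diagonal splits this area into two
    parts of the same sign, so both parameters lie in [[0, 1]]. *)
Lemma diagonals_meet (R : realType) (a b c d : pt R) :
  orient a b c < 0 -> orient a b d < 0 -> orient a c d < 0 -> orient b c d < 0 ->
  exists x, on_seg a c x /\ on_seg b d x.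
Proof.
move=> abc abd acd bcd.
pose D := orient a b d + orient b c d.
have D0 : D < 0 by rewrite /D; lra.
have eD : D = orient a b c + orient a c d by rewrite /D /orient; ring.
have Dn0 : D != 0 by rewrite lt_eqF.
have in01 u : D <= u -> u <= 0 -> 0 <= u / D <= 1.
  by move=> Du u0; rewrite ler_ndivlMr // ler_ndivrMr // mul0r mul1r u0 Du.
exists (a.1 + orient a b d / D * (c.1 - a.1), a.2 + orient a b d / D * (c.2 - a.2)).
split; [exists (orient a b d / D) | exists (orient a b c / D)].
  by split; [apply: in01; rewrite /D; lra | split].
split; first by apply: in01; rewrite ?eD; lra.
have clear u v w : (u + w / D * v) * D = u * D + w * v by rewrite mulrDl mulrAC divfK.
by split=> /=; apply: (mulIf Dn0); rewrite !clear /D /orient; ring.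
Qed.

Lemma set2_inj (T : finType) (i j u v : T) : [set i; j] = [set u; v] ->
  (i = u /\ j = v) \/ (i = v /\ j = u).
Proof.
move=> /setP e; move: (e i) (e j) (e u) (e v); rewrite !inE !eqxx !orbT /=.
by do 2![move=> /esym/orP[]/eqP ?]; do 2![move=> /orP[]/eqP ?]; subst; auto.
Qed.

(** * Transfer of a drawn partition to indices *)

Section PathComponents.
Variables (R : realType) (n : nat) (p : 'I_n -> pt R) (E : {set {set 'I_n}}).
Hypothesis convex : convex_clockwise p.
Hypothesis ordE : ordered_ncp_partition p E.

Definition nat_adj (x y : nat) :=
  [exists i : 'I_n, [exists j : 'I_n, [&& i == x :> nat, j == y :> nat & [set i; j] \in E]]].

Definition nat_comp (s : seq nat) := exists t : seq 'I_n, s = map val t /\ is_path_comp E t.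

Lemma nat_adjP x y : reflect (exists i j : 'I_n, [/\ val i = x, val j = y & [set i; j] \in E])
  (nat_adj x y).
Proof.
apply: (iffP existsP) => [[i /existsP[j /and3P[/eqP ix /eqP jy ij]]]|[i [j [ix jy ij]]]].
  by exists i, j.
by exists i; apply/existsP; exists j; rewrite -ix -jy !eqxx.
Qed.

Lemma nat_adj_val (i j : 'I_n) : nat_adj i j = ([set i; j] \in E).
Proof.
apply/nat_adjP/idP => [[i' [j' [/val_inj-> /val_inj-> //]]]|ij].
by exists i, j.
Qed.

Lemma nat_adjC : symmetric nat_adj.
Proof.
have imp x y : nat_adj x y -> nat_adj y x.
  by move=> /nat_adjP[i [j [<- <- ij]]]; rewrite nat_adj_val setUC.
by move=> x y; apply/idP/idP => /imp.
Qed.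

Lemma nat_adj_lt x y : nat_adj x y -> (x < n)%N && (y < n)%N.
Proof. by move=> /nat_adjP[i [j [<- <- _]]]; rewrite !ltn_ord. Qed.

(** Interleaved edges are the diagonals of a convex quadrilateral, so they meet; the meeting point
    would have to be a common vertex, but the four indices are distinct. *)
Lemma nat_adj_noncrossing a b c d : (a < b)%N -> (b < c)%N -> (c < d)%N ->
  nat_adj a c -> nat_adj b d -> False.
Proof.
move=> ab bc cd /nat_adjP[i [k [ia kc ik]]] /nat_adjP[j [l [jb ld jl]]].
have [[_ [ncE _]] _] := ordE; have [_ cw] := convex.
have [ij jk kl] : [/\ (i < j)%N, (j < k)%N & (k < l)%N] by move: ab bc cd; rewrite -ia -kc -jb -ld.
have ik' := ltn_trans ij jk; have jl' := ltn_trans jk kl.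
have [x [xik xjl]] := diagonals_meet (cw i j k ij jk) (cw i j l ij jl')
  (cw i k l ik' kl) (cw j k l jk kl).
have ne : [set i; k] != [set j; l].
  by apply/eqP => /set2_inj[] [e1 e2]; subst; lia.
have [y [yy _]] := ncE _ _ ik jl ne i k j l x erefl erefl xik xjl.
by move: yy; rewrite !inE => /andP[/orP[]/eqP e1 /orP[]/eqP e2]; subst; lia.
Qed.

Lemma pedgesP (s : seq 'I_n) e :
  reflect (exists x y, consec s x y /\ e = [set x; y]) (e \in pedges s).
Proof.
apply: (iffP mapP) => [[[x y] xy ->]|[x [y [xy ->]]]]; first by exists x, y.
by exists (x, y).
Qed.

Lemma is_path_comp_rev s : is_path_comp E s -> is_path_comp E (rev s).
Proof.
have ped e : (e \in pedges (rev s)) = (e \in pedges s).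
  by apply/pedgesP/pedgesP => -[x [y [xy ->]]]; exists y, x; rewrite setUC;
    split=> //; move: xy; rewrite consec_rev.
move=> [s0 [us [h1 h2]]]; split; first by rewrite -size_eq0 size_rev size_eq0.
split; first by rewrite rev_uniq.
split=> e; last by rewrite ped; apply: h2.
by move=> eE [x [xe xs]]; rewrite ped; apply: h1 => //; exists x; rewrite -mem_rev.
Qed.

Lemma zip_behead_map (S T : Type) (f : S -> T) s : zip (map f s) (behead (map f s)) =
  [seq (f xy.1, f xy.2) | xy <- zip s (behead s)].
Proof. by elim: s => [|x [|y s] IHs] //=; rewrite -IHs. Qed.

Lemma consec_map (s : seq 'I_n) x y : consec (map val s) x y ->
  exists i j, [/\ val i = x, val j = y & consec s i j].
Proof.
rewrite /consec zip_behead_map => /mapP[[i j] ij [-> ->]].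
by exists i, j.
Qed.

Lemma consec_val (s : seq 'I_n) i j : consec s i j -> consec (map val s) (val i) (val j).
Proof. by rewrite /consec zip_behead_map => ij; apply/mapP; exists (i, j). Qed.

Lemma nat_comp_uniq s : nat_comp s -> uniq s.
Proof. by move=> [t [-> [_ [ut _]]]]; rewrite map_inj_uniq //; apply: val_inj. Qed.

Lemma nat_comp_adj s x y : nat_comp s -> consec s x y -> nat_adj x y.
Proof.
move=> [t [-> [_ [_ [_ h]]]]] /consec_map[i [j [<- <- ij]]].
by rewrite nat_adj_val; apply: h; apply/pedgesP; exists i, j.
Qed.

Lemma nat_adj_comp s x y : nat_comp s -> x \in s -> nat_adj x y ->
  consec s x y || consec s y x.
Proof.
move=> [t [-> [_ [_ [h _]]]]] xs /nat_adjP[i [j [ix jy ij]]].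
move: xs; rewrite -ix (mem_map val_inj) => it.
have /pedgesP[u [v [uv e]]] : [set i; j] \in pedges t.
  by apply: h => //; exists i; rewrite !inE eqxx.
rewrite -jy; case: (set2_inj e) => -[-> ->].
- by rewrite consec_val.
- by rewrite orbC consec_val.
Qed.

Lemma nat_comp_rev s : nat_comp s -> nat_comp (rev s).
Proof.
move=> [t [-> ct]]; exists (rev t); rewrite map_rev; split=> //.
exact: is_path_comp_rev.
Qed.

Lemma nat_comp_cover x : (x < n)%N -> exists s, nat_comp s /\ x \in s.
Proof.
move=> xn; have [[_ [_ /(_ (Ordinal xn)) [t [xt ct]]]] _] := ordE.
exists (map val t); split; first by exists t.
by apply/mapP; exists (Ordinal xn).
Qed.

Lemma nat_comp_ordered i s y t : nat_comp (i :: s) -> nat_comp (y :: t) ->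
  (forall x, x \in y :: t -> x \notin i :: s) -> (i < y < last i s)%N -> False.
Proof.
move=> [[|i' s'] [//= [-> ->] cs]] [[|y' t'] [//= [-> ->] ct]] dis /andP[iy yl].
have [_ ord] := ordE; rewrite last_map in yl.
apply: (ord (i' :: s') (y' :: t') i' (last i' s') y' cs ct).
- move=> x xt; have := dis (val x); rewrite -!map_cons !(mem_map val_inj).
  by apply.
- by exists i', s'; split; [|left].
- by exists i', s'; split; [|right].
- exact: ltn_trans iy yl.
- by exists y', t'; split; [|left].
- by split.
Qed.

Lemma edges_listed : exists2 e, e \in genF n.+1 0 n &
  forall i j : 'I_n, ([set i; j] \in E) = ((val i, val j) \in e) || ((val j, val i) \in e).
Proof.
have [e he re] := comp_edges_listed nat_adjC nat_adj_noncrossing nat_comp_uniq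
  nat_comp_adj nat_adj_comp nat_comp_rev nat_comp_cover nat_comp_ordered nat_adj_lt.
by exists e => // i j; rewrite -nat_adj_val re.
Qed.
End PathComponents.

(** * The final count *)

Lemma num_ordered_ncp_le (R : realType) n (p : 'I_n -> pt R) :
  convex_clockwise p -> (num_ordered_ncp p <= size (genF n.+1 0 n))%N.
Proof.
move=> cp; pose L (e : edge_list) : {set {set 'I_n}} :=
  [set A | [exists i : 'I_n, [exists j : 'I_n,
     (A == [set i; j]) && (((val i, val j) \in e) || ((val j, val i) \in e))]]].
(* Every ordered partition is the decoding under [L] of some listed edge list, so there are at most
   as many partitions as lists. *)
rewrite /num_ordered_ncp -(size_map L); apply: leq_trans (card_size _).
apply/subset_leq_card/subsetP => E; rewrite inE => /asboolP ordE.
have [e he re] := edges_listed cp ordE; apply/mapP; exists e => //.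
apply/setP => A; rewrite inE.
apply/idP/existsP => [AE|[i /existsP[j /andP[/eqP ->]]]]; last by rewrite -re.
have [[ok _] _] := ordE; have /eqP/cards2P[i [j [_ eA]]] := ok A AE.
by exists i; apply/existsP; exists j; rewrite eA eqxx -re -eA.
Qed.

(* [F], [W], [H] are close to the values of the generating functions at their
   singularity, where a super-solution at [c^-1] has the largest margin. *)
Lemma size_genF_numeric (R : realFieldType) (c F W H : R) :
  c = 4642126305%:R / 1000000000%:R ->
  F = 1875110104%:R / 1000000000%:R ->
  W = 1061173126%:R / 1000000000%:R ->
  H = 1126088403%:R / 1000000000%:R ->
  forall k n, (size (genF k 0 n))%:R <= F * c ^+ n.
Proof.
move=> ec eF eW eH k n; have ez : c^-1 = 1000000000%:R / 4642126305%:R.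
  by rewrite ec invf_div; reflexivity.
rewrite -[c]invrK; move: (c^-1) ez => z ez; clear ec.
apply: (@size_genF_bound R z F W H); rewrite ?eF ?eW ?eH ?ez; lra.
Qed.

Unset Implicit Arguments.

Theorem theorem5 (R : realType) :
  exists (C : R) (k : nat), forall (n : nat) (p : 'I_n -> pt R),
    convex_clockwise p ->
    (num_ordered_ncp p)%:R <=
      C * (n.+1)%:R ^+ k * (4642126305%:R / 1000000000%:R) ^+ n.
Proof.
(* The constant is the [F] component of the super-solution; the bound is purely exponential, hence
   the exponent 0. *)
exists (1875110104%:R / 1000000000%:R), 0%N => n p cp; rewrite expr0 mulr1.
apply: le_trans (size_genF_numeric erefl erefl erefl erefl n.+1 n).
by rewrite ler_nat num_ordered_ncp_le.
Qed.
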